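(* For $n$ large enough, every linear trifferent code of length $n$ has size at most $3^{n/4.55}$.
   Context: A linear trifferent code of length $n$ is a linear subspace $C\subseteq\mathbb{F}_3^n$ such that for any three distinct $x,y,z\in C$ there is a coordinate $i$ with $\{x_i,y_i,z_i\}=\mathbb{F}_3$. *)

(* Defs.v *)
From mathcomp Require Import all_boot all_order all_algebra all_field.
From Stdlib Require Import Reals.
Set Implicit Arguments. Unset Strict Implicit. Unset Printing Implicit Defensive.

Local Open Scope ring_scope.

Definition trifferent (n : nat) (C : {vspace 'rV['F_3]_n}) : Prop :=
  forall x y z : 'rV['F_3]_n,
    x \in C -> y \in C -> z \in C ->
    x != y -> y != z -> x != z ->
    exists i : 'I_n, [set x ord0 i; y ord0 i; z ord0 i] = [set: 'F_3].

Definition code_size (n : nat) (C : {vspace 'rV['F_3]_n}) : nat :=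
  #|[set x : 'rV['F_3]_n | x \in C]|.

(* Main.v *)
From HB Require Import structures.
Require Import Defs.
From mathcomp Require Import all_boot all_order all_algebra all_field.
From mathcomp Require Import ring lra zify.
From Stdlib Require BinInt Znat.
Set Implicit Arguments. Unset Strict Implicit. Unset Printing Implicit Defensive.
Import Order.TTheory GRing.Theory Num.Theory.
Local Open Scope ring_scope.

(** Let [C] be a trifferent code of dimension [k], and [c] a nonzero word of [C].
    Fix [s] in the support of [c]; on the hyperplane [u_s = 0] of [C], the product
    of [1 - u_i c_i] over the other support positions [i] is the indicator of
    [u = 0], because trifference applied to [0, -u, c] makes some factor vanish.
    A product of fewer than [2 (k - 1)] affine functions sums to zero over a
    [(k - 1)]-dimensional space, so [c] has weight at least [2 k - 1].

    Inserting this distance into the first linear programming bound over [F_3]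
    gives the rate.  That bound is proved as by Navon and Samorodnitsky: if
    [f >= 0] is supported on a Hamming ball [B] and [A f >= lam f] for the adjacency
    operator [A] of the Hamming graph, then testing the characters [u] in [C], on
    which [A] acts by [2 n - 3 wt u], yields [(lam - 2 n + 3 d) |C| <= 3 d |B|]. *)

(** * Arithmetic of [F_3], weights and the dot product *)

Lemma F3_cases (a : 'F_3) : [\/ a = 0, a = 1 | a = -1].
Proof.
by case: a => [[|[|[|m]]]] // i; [apply: Or31 | apply: Or32 | apply: Or33];
  apply/val_inj.
Qed.

Lemma F3_add11 : 1 + 1 = -1 :> 'F_3. Proof. exact/val_inj. Qed.
Lemma F3_addN1N1 : -1 - 1 = 1 :> 'F_3. Proof. exact/val_inj. Qed.
Lemma F3_N1_neq0 : (-1 == 0 :> 'F_3) = false. Proof. by []. Qed.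

Definition wt n (x : 'rV['F_3]_n) : nat := #|[pred i | x 0 i != 0]|.

Definition dot n (u x : 'rV['F_3]_n) : 'F_3 := \sum_i u 0 i * x 0 i.

Lemma dotDr n (u x y : 'rV['F_3]_n) : dot u (x + y) = dot u x + dot u y.
Proof. by rewrite /dot -big_split; apply: eq_bigr => i _; rewrite !mxE mulrDr. Qed.

Lemma dotNr n (u x : 'rV['F_3]_n) : dot u (- x) = - dot u x.
Proof. by rewrite /dot -sumrN; apply: eq_bigr => i _; rewrite !mxE mulrN. Qed.

Lemma dotDl n (u v x : 'rV['F_3]_n) : dot (u + v) x = dot u x + dot v x.
Proof. by rewrite /dot -big_split; apply: eq_bigr => i _; rewrite !mxE mulrDl. Qed.

Lemma dotNl n (u x : 'rV['F_3]_n) : dot (- u) x = - dot u x.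
Proof. by rewrite /dot -sumrN; apply: eq_bigr => i _; rewrite !mxE mulNr. Qed.

Lemma dot_delta n (u : 'rV['F_3]_n) i : dot u (delta_mx 0 i) = u 0 i.
Proof.
rewrite /dot (bigD1 i) //= !mxE !eqxx mulr1 big1 ?addr0 // => j ji.
by rewrite mxE (negPf ji) andbF mulr0.
Qed.

(** * The first linear programming bound *)

Section LinearProgramming.
Variable R : realFieldType.

(* [chi] is [2 cos (2 pi a / 3)]; [sgn3] is the sine, up to a factor. *)
Definition chi (a : 'F_3) : R := if a == 0 then 2 else -1.
Definition sgn3 (a : 'F_3) : R := if a == 0 then 0 else if a == 1 then 1 else -1.

Lemma chiM a b : chi a * chi b = chi (a + b) + chi (a - b).
Proof.
by case: (F3_cases a) => ->; case: (F3_cases b) => ->;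
  rewrite /chi !(F3_add11, F3_addN1N1, F3_N1_neq0, oner_eq0, eqxx, addr0, add0r,
    subrr, oppr0, opprK, addNr); ring.
Qed.

(** The cosine of a difference. Both coefficients are positive, which makes [form u f f] a positive
    combination of squares. *)
Lemma chiB a b : chi (a - b) = chi a * chi b / 2 + 3 / 2 * (sgn3 a * sgn3 b).
Proof.
by case: (F3_cases a) => ->; case: (F3_cases b) => ->;
  rewrite /chi /sgn3 !(F3_add11, F3_addN1N1, F3_N1_neq0, oner_eq0, eqxx, addr0, add0r,
    subrr, oppr0, opprK, addNr) /=; field.
Qed.

Variable n : nat.
Implicit Types (u x y : 'rV['F_3]_n) (f g : 'rV['F_3]_n -> R) (C : {vspace 'rV['F_3]_n}).

Definition adj f x : R := \sum_i (f (x + delta_mx 0 i) + f (x - delta_mx 0 i)).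

(** For [g = f] this is twice the squared modulus of the Fourier coefficient of [f] at [u],
    expressed without complex numbers. *)
Definition form u f g : R := \sum_x \sum_y f x * g y * chi (dot u (x - y)).

Lemma form_sqr u f :
  form u f f = (\sum_x f x * chi (dot u x)) ^+ 2 / 2
             + 3 / 2 * (\sum_x f x * sgn3 (dot u x)) ^+ 2.
Proof.
rewrite !expr2 !big_distrlr /= mulr_sumr mulr_suml -big_split /form /=.
apply: eq_bigr => x _; rewrite mulr_sumr mulr_suml -big_split /=.
by apply: eq_bigr => y _; rewrite dotDr dotNr chiB; field.
Qed.

Lemma form_ge0 u f : 0 <= form u f f.
Proof.
rewrite form_sqr; apply: addr_ge0; apply: mulr_ge0; rewrite ?sqr_ge0 //; lra.
Qed.

Lemma form0 f : form 0 f f = 2 * (\sum_x f x) ^+ 2.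
Proof.
rewrite expr2 big_distrlr /= mulr_sumr; apply: eq_bigr => x _.
rewrite mulr_sumr; apply: eq_bigr => y _.
have -> : dot 0 (x - y) = 0 by rewrite /dot big1 // => i _; rewrite mxE mul0r.
rewrite /chi eqxx. ring.
Qed.

Lemma form_translate u f g v :
  form u f (fun y => g (y + v)) = \sum_x \sum_y f x * g y * chi (dot u (x - y) + dot u v).
Proof.
apply: eq_bigr => x _; rewrite (reindex_inj (addIr (- v))) /=.
by apply: eq_bigr => y _; rewrite subrK -dotDr opprB addrA addrAC.
Qed.

Lemma sum_chi u : \sum_i chi (u 0 i) = 2 * n%:R - 3 * (wt u)%:R.
Proof.
have -> : \sum_i chi (u 0 i) = \sum_(i < n) (2 - 3 * (u 0 i != 0)%:R).
  by apply: eq_bigr => i _; rewrite /chi; case: eqP => _ /=; ring.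
rewrite big_split sumr_const card_ord /= sumrN -mulr_sumr -natr_sum.
rewrite (_ : 2 *+ n = 2 * n%:R) ?mulr_natr //.
have -> // : wt u = (\sum_(i < n) (u 0%R i != 0%R))%N.
by rewrite /wt -sum1_card big_mkcond; apply: eq_bigr => i _; rewrite inE; case: eqP.
Qed.

(** By [chiM], the translates by plus and minus the [i]-th unit vector together multiply the
    character by [chi (u 0 i)]; [sum_chi] adds these up to the eigenvalue. *)
Lemma form_adj u f : form u f (adj f) = (2 * n%:R - 3 * (wt u)%:R) * form u f f.
Proof.
have -> : form u f (adj f) = \sum_i (form u f (fun y => f (y + delta_mx 0 i))
     + form u f (fun y => f (y - delta_mx 0 i))).
  rewrite /form /adj; under eq_bigr => x _ do
    under eq_bigr => y _ do rewrite mulr_sumr mulr_suml.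
  under eq_bigr => x _ do rewrite exchange_big /=.
  rewrite exchange_big /=; apply: eq_bigr => i _.
  rewrite -big_split; apply: eq_bigr => x _ /=.
  by rewrite -big_split; apply: eq_bigr => y _ /=; ring.
rewrite -sum_chi mulr_suml; apply: eq_bigr => i _.
rewrite !form_translate dotNr dot_delta -big_split /= /form mulr_sumr.
apply: eq_bigr => x _; rewrite -big_split /= mulr_sumr.
by apply: eq_bigr => y _; rewrite mulrCA [chi _ * _]mulrC chiM mulrDr.
Qed.

(** Up to the factor [2 |C|], the indicator of the dual code. *)
Definition code_kernel C x : R := \sum_(u in C) chi (dot u x).

Lemma sum_form C f g :
  \sum_(u in C) form u f g = \sum_x \sum_y f x * g y * code_kernel C (x - y).
Proof.
rewrite exchange_big; apply: eq_bigr => x _.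
rewrite exchange_big; apply: eq_bigr => y _.
by rewrite /code_kernel mulr_sumr.
Qed.

Lemma code_kernel0 C : code_kernel C 0 = 2 * #|C|%:R.
Proof.
rewrite /code_kernel (eq_bigr (fun _ => 2)) ?sumr_const ?mulr_natr // => u _.
by rewrite /dot big1 /chi ?eqxx // => i _; rewrite mxE mulr0.
Qed.

(* The kernel [K] is an unnormalised projection: [K ^ 2 = 2 |C| K]. *)
Lemma code_kernel_ge0 C x : 0 <= code_kernel C x.
Proof.
have C_gt0 : 0 < 2 * #|C|%:R :> R.
  by rewrite mulr_gt0 ?ltr0n //; apply/card_gt0P; exists 0; rewrite mem0v.
suff E : code_kernel C x ^+ 2 = 2 * #|C|%:R * code_kernel C x.
  by rewrite -(pmulr_rge0 _ C_gt0) -E sqr_ge0.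
rewrite expr2 {1}/code_kernel mulr_suml.
have E u : u \in C -> chi (dot u x) * code_kernel C x =
    code_kernel C x + code_kernel C x.
  move=> uC; rewrite /code_kernel mulr_sumr.
  under eq_bigr => v _ do rewrite chiM -dotNl -!dotDl.
  rewrite big_split /=; congr (_ + _).
    rewrite [RHS](reindex_inj (addrI u)) /=.
    by apply: eq_bigl => v; rewrite rpredDl.
  rewrite [RHS](reindex_inj (can_inj (subKr u))) /=.
  by apply: eq_bigl => v; rewrite rpredBl.
by rewrite (eq_bigr _ E) sumr_const -mulr_natr; ring.
Qed.

(** The form summed over [C] is squeezed: nonnegativity of [f] and of the kernel bounds it below,
    the eigenvalues bound it above. Keeping only the diagonal of [Q] and applying Cauchy-Schwarz on
    [S] then eliminates [f]. *)
Lemma linear_programming_bound C (d : nat) f (lam : R) (S : {pred 'rV['F_3]_n}) :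
    (forall u, u \in C -> u != 0 -> (d <= wt u)%N) ->
    (forall x, 0 <= f x) -> (exists x, f x != 0) ->
    (forall x, f x != 0 -> x \in S) ->
    (forall x, lam * f x <= adj f x) ->
  (lam - 2 * n%:R + 3 * d%:R) * #|C|%:R <= 3 * d%:R * #|S|%:R.
Proof.
move=> dC f_ge0 [x0 fx0] fS f_lam.
set Q := \sum_(u in C) form u f f.
set F2 := \sum_x f x ^+ 2.
have F2_gt0 : 0 < F2.
  rewrite /F2 (bigD1 x0) //= ltr_pwDl ?sumr_ge0 // => [|x _]; last exact: sqr_ge0.
  by rewrite exprn_gt0 // lt_def fx0 f_ge0.
have lower : lam * Q <= \sum_(u in C) form u f (adj f).
  rewrite /Q !sum_form mulr_sumr ler_sum // => x _.
  rewrite mulr_sumr ler_sum // => y _.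
  have -> : lam * (f x * f y * code_kernel C (x - y)) =
    f x * (lam * f y) * code_kernel C (x - y) by ring.
  by rewrite ler_wpM2r ?code_kernel_ge0 // ler_wpM2l.
have upper : \sum_(u in C) form u f (adj f) <=
    (2 * n%:R - 3 * d%:R) * Q + 6 * d%:R * (\sum_x f x) ^+ 2.
  (* At [u = 0] the eigenvalue [2 n] exceeds [2 n - 3 d] by [3 d]; this excess multiplies
     [form 0 f f]. *)
  have -> : 6 * d%:R * (\sum_x f x) ^+ 2 = 3 * d%:R * form 0 f f.
    by rewrite form0; ring.
  rewrite /Q (bigD1 0) ?mem0v //= [X in _ * X](bigD1 0) ?mem0v //=.
  rewrite form_adj /wt eq_card0 => [|i]; last by rewrite !inE mxE eqxx.
  rewrite mulrDr -addrA [_ * _ + 3 * _ * _]addrC addrA -mulrDl.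
  rewrite mulr0 subr0 subrK lerD2l mulr_sumr ler_sum // => u /andP [uC u0].
  rewrite form_adj ler_wpM2r ?form_ge0 // lerD2l lerN2 ler_pM2l ?ltr0n //.
  by rewrite ler_nat dC.
have Q_ge : 2 * #|C|%:R * F2 <= Q.
  rewrite /Q sum_form mulr_sumr ler_sum // => x _.
  rewrite (bigD1 x) //= subrr code_kernel0 -subr_ge0.
  rewrite [X in X - _]addrC -addrA [X in _ + X](_ : _ = 0) ?addr0; last by ring.
  by apply: sumr_ge0 => y _; rewrite !mulr_ge0 ?code_kernel_ge0.
have CS : (\sum_x f x) ^+ 2 <= #|S|%:R * F2.
  have sumS (h : R -> R) : h 0 = 0 -> \sum_x h (f x) = \sum_(x in S) h (f x).
    move=> h0; rewrite [RHS]big_mkcond; apply: eq_bigr => x _.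
    by case: ifP => // /negP xS; case: (eqVneq (f x) 0) => [->//|/fS/xS].
  rewrite (sumS id) // /F2 (sumS (fun t => t ^+ 2)) ?expr0n //.
  have : 0 <= \sum_(x in S) \sum_(y in S) (f x - f y) ^+ 2.
    by apply: sumr_ge0 => x _; apply: sumr_ge0 => y _; exact: sqr_ge0.
  have -> : \sum_(x in S) \sum_(y in S) (f x - f y) ^+ 2 =
     2 * (#|S|%:R * (\sum_(x in S) f x ^+ 2) - (\sum_(x in S) f x) ^+ 2).
    have E x : x \in S -> \sum_(y in S) (f x - f y) ^+ 2 =
       f x ^+ 2 * #|S|%:R + \sum_(y in S) f y ^+ 2 - 2 * f x * \sum_(y in S) f y.
      move=> _; rewrite (eq_bigr (fun y => f x ^+ 2 + - (2 * f x) * f y + f y ^+ 2)).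
        by rewrite !big_split /= sumr_const -mulr_sumr -[_ *+ #|S|]mulr_natr; ring.
      by move=> y _; ring.
    rewrite (eq_bigr _ E) !big_split /= sumr_const sumrN -!mulr_suml -mulr_natr.
    by rewrite -mulr_sumr; ring.
  by rewrite pmulr_rge0 ?ltr0n // subr_ge0.
have [neg|pos] := lerP (lam - 2 * n%:R + 3 * d%:R) 0.
  by rewrite (@le_trans _ _ 0) ?mulr_ge0 ?ler0n // mulr_le0_ge0 ?ler0n.
have main : (lam - 2 * n%:R + 3 * d%:R) * Q <= 6 * d%:R * (#|S|%:R * F2).
  have : 6 * d%:R * (\sum_x f x) ^+ 2 <= 6 * d%:R * (#|S|%:R * F2).
    by rewrite ler_wpM2l // mulr_ge0 ?ler0n.
  lra.
have : (lam - 2 * n%:R + 3 * d%:R) * (2 * #|C|%:R * F2) <= 6 * d%:R * (#|S|%:R * F2).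
  by apply: le_trans main; rewrite ler_wpM2l // ltW.
rewrite (_ : _ * (2 * _ * _) =
  ((lam - 2 * n%:R + 3 * d%:R) * #|C|%:R) * (2 * F2)); last by ring.
rewrite (_ : 6 * _ * _ = (3 * d%:R * #|S|%:R) * (2 * F2)); last by ring.
by rewrite ler_pM2r // mulr_gt0.
Qed.
End LinearProgramming.

(** * Minimum distance of a trifferent code *)

Lemma F3_sum_expr e : (e < 2)%N -> \sum_(a : 'F_3) a ^+ e = 0 :> 'F_3.
Proof.
by case: e => [|[|//]] _; rewrite !big_ord_recl big_ord0; apply/val_inj.
Qed.

(* A monomial of degree less than [2k] has some exponent below [2], so its sum
   over [F_3^k] vanishes. *)
Lemma sum_prod_affine (I : finType) k (a : I -> 'F_3) (b : I -> 'I_k -> 'F_3) :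
    (#|I| < 2 * k)%N ->
  \sum_(t : {ffun 'I_k -> 'F_3}) \prod_i (a i + \sum_j b i j * t j) = 0.
Proof.
move=> small.
(* [None] selects the constant term of a factor and [Some j] its [j]-th linear term, so functions
   [g] index the expanded monomials. *)
pose c i (o : option 'I_k) := if o is Some j then b i j else a i.
pose tau (t : {ffun 'I_k -> 'F_3}) o := if o is Some j then t j else 1.
have E (t : {ffun 'I_k -> 'F_3}) : \prod_i (a i + \sum_j b i j * t j) =
    \sum_(g : {ffun I -> option 'I_k}) (\prod_i c i (g i)) * (\prod_i tau t (g i)).
  have E1 i : true -> a i + \sum_j b i j * t j = \sum_o c i o * tau t o.
    move=> _; rewrite (bigD1 None) //= mulr1 (reindex_omap Some id) //= => [|[]//].
    by congr (_ + _); apply: eq_bigl => j; rewrite eqxx.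
  rewrite (eq_bigr _ E1) bigA_distr_bigA /=.
  by apply: eq_bigr => g _; rewrite big_split.
under eq_bigr => t _ do rewrite E.
rewrite exchange_big big1 //= => g _.
rewrite -mulr_sumr; apply/eqP; rewrite mulf_eq0; apply/orP; right; apply/eqP.
pose e j := #|[pred i | g i == Some j]|.
have Et (t : {ffun 'I_k -> 'F_3}) : \prod_i tau t (g i) = \prod_j t j ^+ e j.
  have E1 i : true -> tau t (g i) = \prod_(j | g i == Some j) t j.
    move=> _; case: (g i) => [j|] /=; last by rewrite big_pred0.
    by rewrite (big_pred1 j) // => j'; rewrite eq_sym.
  rewrite (eq_bigr _ E1) (exchange_big_dep xpredT) //=.
  by apply: eq_bigr => j _; rewrite prodr_const.
under eq_bigr => t _ do rewrite Et.
rewrite -(bigA_distr_bigA (fun j (s : 'F_3) => s ^+ e j)) /=.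
(* Pigeonhole: the exponents add up to at most [#|I| < 2 * k]. *)
have [j ej] : exists j, (e j < 2)%N.
  apply/existsP; apply: contraLR small; rewrite negb_exists => /forallP H.
  rewrite -leqNgt mulnC -[X in (X * 2)%N]card_ord -sum_nat_const.
  apply: (@leq_trans (\sum_(j < k) e j)).
    by apply: leq_sum => j _; rewrite leqNgt H.
  have -> : (\sum_(j < k) e j = \sum_i \sum_(j < k | g i == Some j) 1)%N.
    rewrite (exchange_big_dep xpredT) //=.
    by apply: eq_bigr => j _; rewrite sum1_card.
  rewrite -sum1_card; apply: leq_sum => i _.
  case: (g i) => [j|] /=; last by rewrite big_pred0.
  by rewrite (big_pred1 j) // => j'; rewrite eq_sym.
by rewrite (bigD1 j) //= F3_sum_expr ?mul0r.
Qed.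

(** Where [0], [- u] and [v] take all three values, [- u] and [v] are the two opposite nonzero
    elements. *)
Lemma trifferent_agree n (C : {vspace 'rV['F_3]_n}) u v : trifferent C ->
    u \in C -> v \in C -> u != 0 -> v != 0 -> u != - v ->
  exists2 i, v 0 i != 0 & u 0 i = v 0 i.
Proof.
move=> tC uC vC u0 v0 uv.
have [||||||i /setP H] := tC 0 (- u) v; rewrite ?mem0v ?rpredN //.
- by rewrite eq_sym oppr_eq0.
- by rewrite -eqr_opp opprK.
- by rewrite eq_sym.
exists i; move: (H 1) (H (-1)); rewrite !inE !mxE;
 case: (F3_cases (u 0 i)) => ->; case: (F3_cases (v 0 i)) => -> //.
Qed.

Lemma trifferent_wt n (C : {vspace 'rV['F_3]_n}) c : trifferent C ->
  c \in C -> c != 0 -> (2 * \dim C <= (wt c).+1)%N.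
Proof.
move=> tC cC c0.
have [s cs] : exists s, c 0 s != 0.
  apply/existsP; apply: contraR c0; rewrite negb_exists => /forallP H.
  by apply/eqP/rowP => i; rewrite mxE; apply/eqP; rewrite -[_ == _]negbK.
pose ev (x : 'rV['F_3]_n) : ('F_3)^o := x 0 s.
have evL : linear ev by move=> a x y; rewrite /ev !mxE.
pose evA := GRing.isLinear.Build _ _ _ _ ev evL.
pose evl : {linear 'rV['F_3]_n -> ('F_3)^o} := HB.pack ev evA.
pose D := (C :&: lker (linfun evl))%VS.
have dimD : (\dim C <= (\dim D).+1)%N.
  rewrite -(limg_ker_dim (linfun evl) C) -(addn1 (\dim D)) leq_add2l.
  by apply: leq_trans (dimvS (subvf _)) _; rewrite dimvf.
have inD u : u \in D -> u \in C /\ u 0 s = 0.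
  by rewrite memv_cap memv_ker lfunE => /andP [uC /eqP].
suff : (2 * \dim D <= (wt c).-1)%N.
  have : (0 < wt c)%N by apply/card_gt0P; exists s.
  lia.
rewrite leqNgt; apply/negP => small.
pose I : finType := {i : 'I_n | (c 0 i != 0) && (i != s)}.
have cardI : #|I| = (wt c).-1.
  rewrite card_sig /wt (cardD1 s [pred i | c 0 i != 0]) inE cs /=.
  by apply: eq_card => i; rewrite !inE andbC.
pose b j := (vbasis D)`_j.
(* The factors are [1 - c_i u_i], with [t] the coordinates of [u] in the basis of [D]. Only [t = 0]
   contributes, and it contributes 1, so the sum cannot vanish. *)
have := @sum_prod_affine I (\dim D) (fun=> 1)
  (fun i j => - (c 0 (val i) * b j 0 (val i))).
rewrite cardI => /(_ small) /eqP; rewrite (bigD1 [ffun=> 0]) //= [X in _ + X]big1.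
  rewrite addr0 big1 ?oner_eq0 // => i _.
  by rewrite big1 ?addr0 // => j _; rewrite ffunE mulr0.
move=> t t0; pose u := \sum_j t j *: b j.
have ui i : u 0 i = \sum_j t j * b j 0 i.
  by rewrite summxE; apply: eq_bigr => j _; rewrite mxE.
have uD : u \in D.
  by apply: rpred_sum => j _; rewrite rpredZ // vbasis_mem // mem_nth // size_tuple.
have u0 : u != 0.
  apply: contra t0 => /eqP u0; apply/eqP/ffunP => j; rewrite ffunE.
  exact: (freeP (basis_free (vbasisP D)) t u0).
have [uC us] := inD u uD.
(* [u = - c] is excluded at [s], where [u] vanishes and [c] does not. *)
have [|i ci uci] := trifferent_agree tC uC cC u0 c0.
  by apply: contra cs => /eqP E; rewrite -oppr_eq0 -us E mxE.
have iI : (c 0 i != 0) && (i != s).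
  by rewrite ci; apply/eqP => E; move: ci; rewrite -uci E us eqxx.
pose i' : I := exist (fun i => (c 0 i != 0) && (i != s)) i iI.
rewrite (bigD1 i') //= [X in X * _](_ : _ = 0) ?mul0r //.
have -> : \sum_(j < \dim D) (- (c 0 i * b j 0 i) * t j) = - (c 0 i * u 0 i).
  by rewrite ui mulr_sumr -sumrN; apply: eq_bigr => j _; ring.
(* Nonzero squares in [F_3] equal 1, so the factor is [1 - 1]. *)
by rewrite uci; case: (F3_cases (c 0 i)) ci => -> //= _; apply/val_inj.
Qed.

(** * Radial functions and Hamming balls *)

Section Radial.
Variables (R : realFieldType) (n : nat).
Implicit Types (x : 'rV['F_3]_n).

Lemma wt_le x : (wt x <= n)%N.
Proof. by rewrite -[X in (_ <= X)%N]card_ord max_card. Qed.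

Lemma exists_wt w : (w <= n)%N -> exists x, wt x = w.
Proof.
move=> wn; exists (\row_i (i < w)%:R); rewrite /wt -sum1_card.
transitivity (\sum_(i < n | i < w) 1)%N; last first.
  by rewrite (big_ord_narrow wn) sum1_card card_ord.
by apply: eq_bigl => i; rewrite !inE mxE; case: ltnP.
Qed.

Lemma wt_translate x i (b : 'F_3) : wt (x + b *: delta_mx 0 i) =
  (wt x + (x 0%R i + b != 0)%R - (x 0%R i != 0%R))%N.
Proof.
rewrite /wt (cardD1 i) (cardD1 i [pred j | x 0 j != 0]) !inE !mxE !eqxx mulr1.
rewrite (eq_card (B := [predD1 [pred j | x 0 j != 0] & i])).
  by rewrite -addnA addKn addnC.
move=> j; rewrite !inE !mxE; case: eqVneq => //= _.
by rewrite mulr0 addr0.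
Qed.

(** Both changes of a zero coordinate raise the weight; of the two changes of a nonzero one, one
    lowers the weight and one keeps it. At weight 0 the default [0.-1] has coefficient 0. *)
Lemma adj_radial (phi : nat -> R) x : adj (phi \o @wt n) x =
  2 * (n - wt x)%:R * phi (wt x).+1 + (wt x)%:R * (phi (wt x).-1 + phi (wt x)).
Proof.
pose P := [pred i | x 0 i != 0].
rewrite /adj (bigID P) /= addrC; congr (_ + _).
  rewrite (eq_bigr (fun=> 2 * phi (wt x).+1)); last first.
    move=> i /negPn /eqP xi; rewrite -[delta_mx 0 i]scale1r -scaleNr.
    rewrite !wt_translate xi !add0r /= subn0 addn1; ring.
  rewrite sumr_const -[_ *+ _]mulr_natr.
  have -> : #|[pred i | ~~ (x 0 i != 0)]| = (n - wt x)%N; last by ring.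
  have E : (wt x + #|[predC P]| = n)%N by rewrite -[RHS]card_ord; exact: cardC.
  by rewrite -[X in (X - _)%N]E addKn; apply: eq_card => i; rewrite !inE.
rewrite (eq_bigr (fun=> phi (wt x).-1 + phi (wt x))).
  by rewrite sumr_const -[_ *+ _]mulr_natl.
move=> i xi; rewrite -[delta_mx 0 i]scale1r -scaleNr !wt_translate.
move: xi; case: (F3_cases (x 0 i)) => -> //= _.
  by rewrite addnK addn0 subn1 addrC.
by rewrite addnK addn0 subn1.
Qed.

Lemma sum_wt_expr (y : R) : \sum_(x : 'rV['F_3]_n) y ^+ wt x = (1 + 2 * y) ^+ n.
Proof.
pose row (g : {ffun 'I_n -> 'F_3}) : 'rV['F_3]_n := \row_i g i.
rewrite (reindex row) /=; last first.
  exists (fun x : 'rV['F_3]_n => [ffun i => x 0 i]) => z _.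
    by apply/ffunP => i; rewrite ffunE mxE.
  by apply/rowP => i; rewrite mxE ffunE.
have E (g : {ffun 'I_n -> 'F_3}) : true -> y ^+ wt (row g) = \prod_i y ^+ (g i != 0).
  move=> _; rewrite prodrXr /wt -sum1_card big_mkcond /=; congr (_ ^+ _).
  by apply: eq_bigr => i _; rewrite !inE mxE; case: eqP.
rewrite (eq_bigr _ E) -(bigA_distr_bigA (fun _ (a : 'F_3) => y ^+ (a != 0))) /=.
rewrite prodr_const card_ord; congr (_ ^+ _).
by rewrite !big_ord_recl big_ord0 /= !expr0 !expr1; ring.
Qed.

(** Each word of the ball contributes at least [y ^+ r] to the weight enumerator. *)
Lemma ball_bound (y : R) (r : nat) : 0 < y -> y <= 1 ->
  #|[pred x : 'rV['F_3]_n | (wt x <= r)%N]|%:R * y ^+ r <= (1 + 2 * y) ^+ n.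
Proof.
move=> y_gt0 y_le1; rewrite -sum_wt_expr mulr_natl -sumr_const big_mkcond.
apply: ler_sum => x _; rewrite inE; case: ifP => [wx|_]; last by rewrite exprn_ge0 // ltW.
by rewrite ler_wiXn2l // ltW.
Qed.

(* A parabola multiplied by a geometric progression: on the window [a < w < a + M]
   it is a subsolution of the three-term recurrence satisfied by the top
   eigenfunction of the ball of radius [a + M]. *)
Definition bumpfun (s : R) (a M w : nat) : R :=
  s ^+ (w - a) * ((w - a) * (a + M - w))%:R.

Lemma bumpfun_ge0 s a M w : 0 <= s -> 0 <= bumpfun s a M w.
Proof. by move=> s0; rewrite mulr_ge0 ?exprn_ge0 ?ler0n. Qed.

Lemma bumpfun_support s a M w : bumpfun s a M w != 0 -> (a < w < a + M)%N.
Proof.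
rewrite mulf_eq0 negb_or pnatr_eq0 muln_eq0 negb_or => /andP [_ /andP[]]; lia.
Qed.

(** The two hypotheses on [K] bound the coefficients of the down and up steps throughout the window.
    For the parabola, [(j + 2) l + j (l + 2) = 2 (j + 1) (l + 1) - 2] with [(j + 1) (l + 1) >= m],
    hence the relative loss [2 / m]. *)
Lemma bumpfun_eigen (s K : R) (a m : nat) x : 0 < s -> (0 < m)%N -> 0 <= K ->
    K * s <= a%:R -> K <= 2 * (n%:R - (a + m.+1)%:R) * s ->
  (a%:R + K * (2 - 2 / m%:R)) * bumpfun s a m.+1 (wt x)
    <= adj (bumpfun s a m.+1 \o @wt n) x.
Proof.
move=> s_gt0 m_gt0 K_ge0 Ka Kn; rewrite adj_radial.
move: (wt x) (wt_le x) => w wn.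
have bump0 v := @bumpfun_ge0 s a m.+1 v (ltW s_gt0).
have [->|/bumpfun_support aw] := eqVneq (bumpfun s a m.+1 w) 0.
  rewrite mulr0 addr0; apply: addr_ge0; apply: mulr_ge0 => //.
  by rewrite -natrM ler0n.
have [j wE] : exists j, w = (a + j.+1)%N by exists (w - a).-1; lia.
have [l mE] : exists l, m = (j + l.+1)%N by exists (a + m - w)%N; lia.
have wa : a%:R <= w%:R :> R by rewrite ler_nat wE leq_addr.
have wM : w%:R <= (a + m.+1)%:R :> R by rewrite ler_nat; lia.
have jl : m%:R <= (j%:R + 1) * (l%:R + 1) :> R.
  by rewrite !natr1 -natrM ler_nat mE; nia.
have b0 : bumpfun s a m.+1 w = s ^+ j * s * (j%:R + 1) * (l%:R + 1).
  rewrite /bumpfun; have [-> ->] : (w - a)%N = j.+1 /\ (a + m.+1 - w)%N = l.+1.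
    by clear -wE mE; lia.
  by rewrite natrM !natr1 exprSr mulrA.
have b1 : bumpfun s a m.+1 w.+1 = s ^+ j * s ^+ 2 * (j%:R + 2) * l%:R.
  rewrite /bumpfun; have [-> ->] : (w.+1 - a)%N = j.+2 /\ (a + m.+1 - w.+1)%N = l.
    by clear -wE mE; lia.
  by rewrite natrM -natrD addn2 -exprD addn2 mulrA.
have bN : bumpfun s a m.+1 w.-1 = s ^+ j * j%:R * (l%:R + 2).
  rewrite /bumpfun; have [-> ->] : (w.-1 - a)%N = j /\ (a + m.+1 - w.-1)%N = l.+2.
    by clear -wE mE; lia.
  by rewrite natrM -natrD addn2 mulrA.
have m_gt0' : 0 < m%:R :> R by rewrite ltr0n.
move: (bump0 w) b0; rewrite b1 bN natrB //; move: (bumpfun s a m.+1 w) => B B_ge0 BE.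
have T_gt0 : 0 < s ^+ j by rewrite exprn_gt0.
have j_ge0 : 0 <= j%:R :> R by [].
have l_ge0 : 0 <= l%:R :> R by [].
move: (s ^+ j) (j%:R) (l%:R) (w%:R) (a%:R) (m%:R) ((a + m.+1)%:R) (n%:R)
  T_gt0 j_ge0 l_ge0 wa wM jl BE m_gt0' Ka Kn.
clear -s_gt0 K_ge0 B_ge0 => T j l w a m r N T_gt0 j_ge0 l_ge0 wa wM jl BE m_gt0 Ka Kn.
have up : K * (T * s * (j + 2) * l) <= 2 * (N - w) * (T * s ^+ 2 * (j + 2) * l).
  rewrite [leRHS](_ : _ = (2 * (N - w) * s) * (T * s * (j + 2) * l)); last by ring.
  apply: ler_wpM2r; first by rewrite !mulr_ge0 ?addr_ge0 // ltW.
  by apply: le_trans Kn _; rewrite ler_pM2r // ler_pM2l // lerB.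
have down : K * (T * s * j * (l + 2)) <= w * (T * j * (l + 2)).
  rewrite [leLHS](_ : _ = (K * s) * (T * j * (l + 2))); last by ring.
  apply: ler_wpM2r; first by rewrite !mulr_ge0 ?addr_ge0 // ltW.
  exact: le_trans Ka wa.
have aB : a * B <= w * B by rewrite ler_wpM2r.
have KB : K * ((2 - 2 / m) * B) <= K * (T * s * (j + 2) * l + T * s * j * (l + 2)).
  rewrite ler_wpM2l // BE.
  have : T * s <= T * s * ((j + 1) * (l + 1) / m).
    by rewrite ler_peMr ?ler_pdivlMr ?mul1r // mulr_ge0 // ltW.
  lra.
lra.
Qed.
End Radial.

(** * Exponential growth and the numerical inequality *)

Lemma expn_dominates (c x z : nat) : (x < z)%N ->
  exists N, forall n, (N <= n)%N -> (c * x ^ n < z ^ n)%N.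
Proof.
move=> xz; exists (x * c).+1 => n Nn.
have [x0|x_gt0] := posnP x.
 by rewrite x0 exp0n ?muln0 ?expn_gt0; lia.
(* Bernoulli's inequality [(1 + 1/x)^m >= 1 + m/x], multiplied by [x^(m+1)]. *)
have bernoulli m : (x ^ m * (x + m) <= x * x.+1 ^ m)%N.
  elim: m => [|m IH]; first by rewrite !expn0; lia.
  rewrite !expnS; have := leq_mul (leqnn x.+1) IH; nia.
have n_gt0 : (0 < n)%N by lia.
have H : (x.+1 ^ n <= z ^ n)%N by rewrite leq_exp2r.
have x_pow : (0 < x ^ n)%N by rewrite expn_gt0 x_gt0.
rewrite -(ltn_pmul2l x_gt0); apply: leq_trans (leq_mul (leqnn x) H).
by apply: leq_trans (bernoulli n); nia.
Qed.

Local Notation toZ := BinInt.Z.of_nat.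

Lemma Z_of_expn m e : toZ (m ^ e) = BinInt.Z.pow (toZ m) (toZ e).
Proof.
elim: e => [//|e IH].
rewrite expnS -multE Znat.Nat2Z.inj_mul Znat.Nat2Z.inj_succ BinInt.Z.pow_succ_r ?IH //.
exact: Znat.Nat2Z.is_nonneg.
Qed.

(* Proves an inequality between numbers of thousands of digits through the short
   integer [u q ^ 60], a rounding of [(p / r) ^ 287 r ^ 15] whose 13th power is
   still below [q ^ 820]; over [Z] both steps are decidable by computation. *)
Lemma expn_gap (p q r u : nat) : (0 < q)%N -> (0 < r)%N ->
    BinInt.Z.leb (BinInt.Z.pow (toZ p) (toZ 287))
      (BinInt.Z.mul (toZ u) (BinInt.Z.mul (BinInt.Z.pow (toZ q) (toZ 60))
                                          (BinInt.Z.pow (toZ r) (toZ 272)))) ->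
    BinInt.Z.ltb (BinInt.Z.pow (toZ u) (toZ 13)) (BinInt.Z.pow (toZ q) (toZ 40)) ->
  (p ^ (287 * 13) < q ^ (40 + 60 * 13) * r ^ (272 * 13))%N.
Proof.
move=> q_gt0 r_gt0 /BinInt.Z.leb_spec0 pu /BinInt.Z.ltb_spec0 uq.
move: pu; rewrite -!Z_of_expn -!Znat.Nat2Z.inj_mul => /Znat.Nat2Z.inj_le /ssrnat.leP pu.
move: uq; rewrite -!Z_of_expn => /Znat.Nat2Z.inj_lt /ssrnat.ltP uq.
have A_gt0 : (0 < q ^ 60)%N by rewrite expn_gt0 q_gt0.
have B_gt0 : (0 < r ^ 272)%N by rewrite expn_gt0 r_gt0.
rewrite expnD !expnM; move: pu uq A_gt0 B_gt0.
move: (p ^ 287)%N (q ^ 40)%N (q ^ 60)%N (r ^ 272)%N => P Q A B pu uq A_gt0 B_gt0.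
apply: (@leq_ltn_trans ((u * (A * B)) ^ 13)); first by rewrite leq_exp2r.
by rewrite (expnMn u) (expnMn A) -mulnA ltn_pmul2r // muln_gt0 !expn_gt0 A_gt0 B_gt0.
Qed.

(** This is [37 < 3^(20/91) 35^(272/287)] raised to the power [287 * 13]: a ball of relative radius
    [15/287], estimated with [y = 1/35] (the optimum is [15/544]), grows more slowly than a code of
    rate [20/91]. *)
Lemma numeric_gap : (37 ^ (287 * 13) < 3 ^ (40 + 60 * 13) * 35 ^ (272 * 13))%N.
Proof.
(* [29] is the largest integer whose 13th power is below [3 ^ 40]. *)
apply: (@expn_gap 37 3 35 29 isT isT).
  by vm_compute.
by vm_compute.
Qed.

(** * Combining the distance, the ball and the growth rates *)

(* [15 / 287] approximates the relative radius at which the top eigenvalue of the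
   ball is [62 / 91 n], which is [2 n - 3 d] for [d = 2 k] and [k = 20 n / 91];
   [38 / 229] and [184 / 585] are the matching ratio and weight for the bump. *)
Lemma trifferent_ball_bound (R : realFieldType) (c m n : nat)
    (C : {vspace 'rV['F_3]_n}) :
    10 ^+ 6 <= m%:R :> R -> 10 ^+ 8 * (m%:R + 1) <= n%:R :> R ->
    6 * 10 ^+ 6 <= c%:R :> R -> trifferent C -> (20 * n < 91 * \dim C)%N ->
  (#|C| <= c * #|[pred x : 'rV['F_3]_n | (wt x <= 15 * n %/ 287 + m.+1)%N]|)%N.
Proof.
move=> m_big n_big c_big tC; set k := \dim C => kn.
have n_gt0 : 0 < n%:R :> R by lra.
have kn' : 20 * n%:R + 1 <= 91 * k%:R :> R.
  by rewrite -!natrM natr1 ler_nat.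
have k_le : k%:R <= n%:R :> R.
  by rewrite ler_nat (leq_trans (dimvS (subvf C))) // dimvf dim_matrix mul1r.
have k_gt0 : (0 < k)%N by move: (k) kn => l; clear; lia.
set a := (15 * n %/ 287)%N; set S := [pred x | _].
have a_le : 287 * a%:R <= 15 * n%:R :> R.
  by rewrite -!natrM ler_nat mulnC leq_divM.
have a_ge : 15 * n%:R <= 287 * a%:R + 287 :> R.
  by rewrite -!natrM -natrD ler_nat /a; clear; lia.
pose d := (2 * k).-1; pose s : R := 38 / 229.
pose K : R := 184 / 585 * n%:R.
have d_eq : d%:R = 2 * k%:R - 1 :> R.
  by rewrite -natrM -(@natrB _ _ 1) ?subn1 ?muln_gt0 //.
have m_gt0 : 0 < m%:R :> R by lra.
have K_ge0 : 0 <= K by rewrite /K; lra.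
have main : (a%:R + K * (2 - 2 / m%:R) - 2 * n%:R + 3 * d%:R) * #|C|%:R
    <= 3 * d%:R * #|S|%:R :> R.
  apply: (@linear_programming_bound R n C d (bumpfun s a m.+1 \o @wt n)).
  - move=> u uC u0; have := trifferent_wt tC uC u0.
    by rewrite -/k /d; move: (2 * k)%N (wt u); clear; lia.
  - by move=> x; apply: bumpfun_ge0; rewrite /s; lra.
  - have [|x wx] := @exists_wt n a.+1.
      by rewrite -(ler_nat R) -natr1; lra.
    exists x; rewrite /= wx /bumpfun subSnn.
    rewrite mul1n mulf_neq0 ?expf_neq0 //; first by rewrite /s; lra.
    by rewrite pnatr_eq0; move: m_gt0; rewrite ltr0n; move: (a); clear; lia.
  - by move=> x /bumpfun_support; rewrite !inE; move: (wt x) (a); clear; lia.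
  move=> x; apply: bumpfun_eigen => //; first by rewrite /s; lra.
  - by rewrite -(ltr0n R).
  - by rewrite /s /K; lra.
  - by rewrite /s /K natrD -natr1; lra.
have Km : K * (2 / m%:R) <= K * (2 / 10 ^+ 6).
  by rewrite ler_wpM2l // ler_pM2l // lef_pV2 // posrE exprn_gt0.
(* [15/287 + 368/585 + 120/91] exceeds 2 by almost [6 / 10^6]; the loss [Km] is below [n / 10^6],
   and [n] is large enough to absorb the rounding of [a] and [d]. *)
have gap : n%:R / 10 ^+ 6 <= a%:R + K * (2 - 2 / m%:R) - 2 * n%:R + 3 * d%:R.
  move: Km; rewrite d_eq mulrBr; move: (K * (2 / m%:R)) => Km.
  by rewrite /K; lra.
have d_le : 3 * d%:R <= 6 * n%:R :> R by rewrite d_eq; lra.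
rewrite -(ler_nat R) natrM -(ler_pM2l n_gt0).
have C1 : n%:R / 10 ^+ 6 * #|C|%:R <= 6 * n%:R * #|S|%:R :> R.
  apply: le_trans (le_trans main _); first by rewrite ler_wpM2r.
  by rewrite ler_wpM2r.
have C2 : (6 * 10 ^+ 6) * (n%:R * #|S|%:R) <= c%:R * (n%:R * #|S|%:R) :> R.
  by rewrite ler_wpM2r // mulr_ge0.
lra.
Qed.

Lemma ball_card n (q r : nat) : (0 < q)%N ->
  (#|[pred x : 'rV['F_3]_n | (wt x <= r)%N]| * q ^ n <= q ^ r * q.+2 ^ n)%N.
Proof.
move=> q_gt0; have q0 : 0 < q%:R :> rat by rewrite ltr0n.
have := @ball_bound rat n q%:R^-1 r; rewrite invr_gt0 q0 invf_le1 // ler1n q_gt0.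
move=> /(_ isT isT); rewrite -(ler_nat rat) !natrM !natrX -(addn2 q) natrD.
have -> : 1 + 2 * q%:R^-1 = (q%:R + 2) / q%:R :> rat by field; lra.
rewrite expr_div_n exprVn ler_pdivlMr ?exprn_gt0 // mulrAC ler_pdivrMr ?exprn_gt0 //.
by rewrite [X in _ -> _ <= X]mulrC.
Qed.

Lemma code_count n (q r c : nat) (C : {vspace 'rV['F_3]_n}) : (0 < q)%N ->
    (#|C| <= c * #|[pred x : 'rV['F_3]_n | (wt x <= r)%N]|)%N ->
  (3 ^ \dim C * q ^ n <= c * (q ^ r * q.+2 ^ n))%N.
Proof.
move=> q_gt0; rewrite card_vspace card_Fp // => C_le.
apply: leq_trans (leq_mul C_le (leqnn _)) _.
by rewrite -mulnA leq_mul2l ball_card ?orbT.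
Qed.

(** The power [e] clears rational rates: [e1 / e] bounds [k / n] from below and [e2 / e] bounds
    [1 - a / n]. What does not grow with [n] is collected in [(c * q ^ m) ^ e]. *)
Lemma expn_count (p q t c k n a m e1 e2 e : nat) : (0 < p)%N -> (0 < q)%N ->
    (p ^ k * q ^ n <= c * (q ^ (a + m) * t ^ n))%N ->
    (e1 * n <= k * e)%N -> (e2 * n + a * e <= n * e)%N ->
  ((p ^ e1 * q ^ e2) ^ n <= (c * q ^ m) ^ e * (t ^ e) ^ n)%N.
Proof.
move=> p_gt0 q_gt0 bound e1n e2n.
have qae : (0 < q ^ (a * e))%N by rewrite expn_gt0 q_gt0.
rewrite -(leq_pmul2r qae).
apply: (@leq_trans ((p ^ k * q ^ n) ^ e)).
  rewrite !expnMn -!expnM -mulnA -expnD.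
  by rewrite leq_mul // leq_pexp2l.
have [->|e_gt0] := posnP e; first by rewrite !(expn0, muln0, exp1n).
apply: (@leq_trans ((c * (q ^ (a + m) * t ^ n)) ^ e)); first by rewrite leq_exp2r.
rewrite expnD !expnMn -!expnM [(e * n)%N]mulnC.
by apply/eq_leq; ring.
Qed.

(** [91 / 20 = 4.55]; a larger dimension would make the code outgrow the ball that bounds it. *)
Lemma trifferent_dim : exists N : nat, forall n, (N <= n)%N ->
  forall C : {vspace 'rV['F_3]_n}, trifferent C -> (91 * \dim C <= 20 * n)%N.
Proof.
have big_nat (b : rat) : exists m : nat, b <= m%:R.
  exists (Num.bound `|b|); apply: le_trans (ler_norm b) _.
  by rewrite ltW // archi_boundP.
(* [m] and [c] are fixed before [n], so they cost only a constant factor, absorbed by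
   [expn_dominates]. *)
have [m m_big] := big_nat (10 ^+ 6).
have [N1 N1_big] := big_nat (10 ^+ 8 * (m%:R + 1)).
have [c c_big] := big_nat (6 * 10 ^+ 6).
have [N2 dom] := expn_dominates ((c * 35 ^ m.+1) ^ (287 * 13)) numeric_gap.
exists (N1 + N2)%N => n Nn C tC; rewrite leqNgt; apply/negP => kn.
have N1n : (N1 <= n)%N by apply: leq_trans Nn; apply: leq_addr.
have N2n : (N2 <= n)%N by apply: leq_trans Nn; apply: leq_addl.
have n_big : 10 ^+ 8 * (m%:R + 1) <= n%:R :> rat.
  by apply: le_trans N1_big _; rewrite ler_nat.
have count := code_count (isT : 0 < 35)%N
  (trifferent_ball_bound m_big n_big c_big tC kn).
move: (dom n N2n); apply/negP; rewrite -leqNgt.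
(* [40 + 60 * 13 = 820] is [20/91] of [287 * 13], and [272 * 13] is [1 - 15/287] of it. *)
refine (@expn_count 3 35 37 c (\dim C) n (15 * n %/ 287) m.+1 (40 + 60 * 13)
  (272 * 13) (287 * 13) isT isT count _ _).
  by move: (\dim C) kn => k; clear; lia.
by clear; lia.
Qed.

(* Passage to real exponents *)
From Stdlib Require Import Reals Lra.
Local Close Scope ring_scope.

Lemma INR_expn3 (k : nat) : INR (expn 3 k) = Rpower 3 (INR k).
Proof.
rewrite Rpower_pow; last by Lra.lra.
by elim: k => [//|k IH]; rewrite expnS mult_INR IH INR_IZR_INZ.
Qed.

Theorem theorem1p5 :
  exists N : nat, forall n : nat, (N <= n)%N ->
    forall C : {vspace 'rV['F_3]_n}, trifferent C ->
      (INR (code_size C) <= Rpower 3 (INR n / (455 / 100)))%R.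
Proof.
have [N dimC] := trifferent_dim; exists N => n Nn C tC.
have -> : code_size C = expn 3 (\dim C).
  by rewrite /code_size cardsE card_vspace card_Fp.
rewrite INR_expn3; apply: Rle_Rpower; first by Lra.lra.
have /ssrnat.leP /le_INR := dimC n Nn C tC.
rewrite !mult_INR !INR_IZR_INZ /=; Lra.lra.
Qed.
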